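(* For $3\le D\le 20000$ there is no graph of degree $5$, diameter $D$ and cyclic defect. Furthermore, for odd $g$ with $7\le g\le 40001$ there is no graph of degree $5$, girth $g$ and cyclic excess.
   Context: For an integer $d\ge 1$ define polynomials $G_{d,m}(x)$ by $G_{d,0}(x)=1$, $G_{d,1}(x)=x+1$, and $G_{d,m+1}(x)=xG_{d,m}(x)-(d-1)G_{d,m-1}(x)$ for $m\ge1$. Let $J_n$ be the $n\times n$ all-ones matrix. For a graph on $n\ge3$ vertices, a cycle matrix is the adjacency matrix $B$ of an $n$-cycle on the same vertex set (i.e., for some ordering $v_1,\dots,v_n$ of the vertices, $B_{ij}=1$ iff $v_i,v_j$ are cyclically consecutive, and $0$ otherwise); this cycle need not consist of edges of the graph. A graph $\Gamma$ of order $n$ with adjacency matrix $A$ is a graph of degree $d$, diameter $D$ and cyclic defect if $\Gamma$ is $d$-regular with $d\ge3$, has diameter $D\ge2$, and $G_{d,D}(A)=J_n+B$ for some cycle matrix $B$. It is a graph of degree $d$, girth $g$ and cyclic excess if $\Gamma$ is $d$-regular with $d\ge3$, has odd girth $g\ge5$, and $G_{d,\lfloor g/2\rfloor}(A)=J_n-B$ for some cycle matrix $B$. *)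

(* Defs.v *)
From mathcomp Require Import all_boot all_order all_algebra all_fingroup.

Set Implicit Arguments.
Unset Strict Implicit.
Unset Printing Implicit Defensive.

Import GRing.Theory.
Local Open Scope ring_scope.

Fixpoint Gpoly (d m : nat) : {poly int} :=
  if m is m1.+1 then
    if m1 is m2.+1 then 'X * Gpoly d m1 - (d%:R - 1) *: Gpoly d m2
    else 'X + 1
  else 1.

(* The vertex set of a graph of order n.+1 is 'I_n.+1; the empty graph is
   excluded, so that horner_mx applies. *)
Definition simple_graph (n : nat) (e : rel 'I_n.+1) : Prop :=
  symmetric e /\ irreflexive e.

Definition regular (n : nat) (e : rel 'I_n.+1) (d : nat) : Prop :=
  forall x, #|[set y | e x y]| = d.

Definition is_dist (n : nat) (e : rel 'I_n.+1) (x y : 'I_n.+1)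
    (k : nat) : Prop :=
  (exists p, [/\ path e x p, last x p = y & size p = k]) /\
  (forall p, path e x p -> last x p = y -> (k <= size p)%N).

(* In particular the graph is connected: each pair has a finite distance. *)
Definition has_diameter (n : nat) (e : rel 'I_n.+1) (D : nat) : Prop :=
  (forall x y, exists2 k, is_dist e x y k & (k <= D)%N) /\
  (exists x y, is_dist e x y D).

(* ucycle accepts sequences of size at most 2, hence the size condition. *)
Definition graph_cycle (n : nat) (e : rel 'I_n.+1) (c : seq 'I_n.+1) : Prop :=
  ucycle e c /\ (3 <= size c)%N.

Definition has_girth (n : nat) (e : rel 'I_n.+1) (g : nat) : Prop :=
  (exists2 c, graph_cycle e c & size c = g) /\
  (forall c, graph_cycle e c -> (g <= size c)%N).

Definition adjacency (n : nat) (e : rel 'I_n.+1) : 'M[int]_n.+1 :=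
  \matrix_(i, j) (e i j)%:R.

(* v lists the vertices in cyclic order; ordS is the successor modulo n.+1. *)
Definition cycle_matrix (n : nat) (B : 'M[int]_n.+1) : Prop :=
  (3 <= n.+1)%N /\
  exists v : {perm 'I_n.+1},
    forall i j, B (v i) (v j) = ((j == ordS i) || (i == ordS j))%:R.

Definition cyclic_defect (n : nat) (e : rel 'I_n.+1) (d D : nat) : Prop :=
  [/\ simple_graph e, regular e d /\ (3 <= d)%N,
      has_diameter e D /\ (2 <= D)%N &
      exists2 B : 'M[int]_n.+1, cycle_matrix B &
        horner_mx (adjacency e) (Gpoly d D) = const_mx 1 + B].

Definition cyclic_excess (n : nat) (e : rel 'I_n.+1) (d g : nat) : Prop :=
  [/\ simple_graph e, regular e d /\ (3 <= d)%N,
      [/\ has_girth e g, odd g & (5 <= g)%N] &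
      exists2 B : 'M[int]_n.+1, cycle_matrix B &
        horner_mx (adjacency e) (Gpoly d g./2) = const_mx 1 - B].

(* Main.v *)
From Stdlib Require Import ZArith.
Require Import Defs.
From mathcomp Require Import all_boot all_order all_algebra all_fingroup.
From mathcomp Require Import zify ssrZ ring.

(** Put [eps = 1] for a defect and [eps = -1] for an excess, so that
    [G(A) = J + eps B].  Applying this to the all-ones vector gives
    [n = G(5) - 2 eps], hence [4 | n].  As the graph is regular, [A] commutes
    with [J], hence with [B].  Therefore [A] preserves the eigenspaces of [B]; those for the eigenvalues
    [-2] and [0] are spanned by the integral waves of period 2 and 4 along the
    cycle.  On the first one [A] acts by an integer [l] with [|l| <= 5] and
    [G_D(l) = -2 eps], which a computation modulo a power of 2 excludes for
    [8 <= D <= 20000].  On the second one [A] acts by an integral 2x2 matrix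
    [M] with entries in [[-5, 5]] and [G_D(M) = 0], which an enumeration
    excludes for [3 <= D <= 7]. *)

Set Implicit Arguments.
Unset Strict Implicit.
Unset Printing Implicit Defensive.

Import Order.TTheory GRing.Theory Num.Theory.
Local Open Scope ring_scope.
(* The key %Z is taken by MathComp's int_scope. *)
Delimit Scope Z_scope with ZZ.

(** * Values of G_m at integers of absolute value at most 5 *)

Lemma nat_ind2 (P : nat -> Prop) :
  P 0%N -> P 1%N -> (forall m, P m -> P m.+1 -> P m.+2) -> forall m, P m.
Proof.
move=> P0 P1 PS m; suff: P m /\ P m.+1 by case.
by elim: m => [|m [Pm PSm]]; split=> //; apply: PS.
Qed.

Lemma GpolySS d m :
  Gpoly d m.+2 = 'X * Gpoly d m.+1 - (d%:R - 1) *: Gpoly d m.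
Proof. by []. Qed.

(** A copy over binary integers that [vm_compute] can run; the factor 4 is d - 1 for d = 5. *)
Fixpoint Geval (l : Z) (m : nat) : Z :=
  if m is m1.+1 then
    if m1 is m2.+1 then (l * Geval l m1 - 4 * Geval l m2)%ZZ else (l + 1)%ZZ
  else 1%ZZ.
Arguments Geval : simpl never.

Lemma GevalSS l m : Geval l m.+2 = (l * Geval l m.+1 - 4 * Geval l m)%ZZ.
Proof. by []. Qed.

Lemma GevalE (l : int) m : Z_of_int (Gpoly 5 m).[l] = Geval (Z_of_int l) m.
Proof.
elim/nat_ind2: m => [||m IH0 IH1].
- by rewrite hornerC.
- by rewrite /= !hornerE rmorphD.
- rewrite GpolySS !hornerE GevalSS -IH0 -IH1.
  by rewrite rmorphB !rmorphM.
Qed.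

Definition small_Z : seq Z :=
  [:: -5; -4; -3; -2; -1; 0; 1; 2; 3; 4; 5]%ZZ.

Lemma small_ZP (l : int) : `|l| <= 5 -> Z_of_int l \in small_Z.
Proof. by move=> l5; rewrite /small_Z !inE; lia. Qed.

(* 2^20 is the least power of 2 modulo which no value G_m(l) with
   8 <= m <= 20000 and |l| <= 5 is congruent to 2 or -2. *)
Definition modulus : Z := 1048576%ZZ.

(** Carrying two consecutive residues [x], [y] keeps the run linear and the numbers small. Residues
    are nonnegative, so -2 appears as [modulus - 2]. *)
Fixpoint avoids_pm2 (l x y : Z) (k : nat) : bool :=
  if k is k1.+1 then
    [&& x != 2%ZZ, x != (modulus - 2)%ZZ
      & avoids_pm2 l y ((l * y - 4 * x) mod modulus)%ZZ k1]
  else true.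

Lemma avoids_pm2P l m k :
  avoids_pm2 l (Geval l m mod modulus)%ZZ (Geval l m.+1 mod modulus)%ZZ k ->
  forall j, (j < k)%N -> Geval l (m + j) <> 2%ZZ /\ Geval l (m + j) <> (-2)%ZZ.
Proof.
elim: k m => [//|k IH] m /= /and3P [/eqP x2 /eqP x2' av] [_|j ltjk].
  rewrite addn0; split=> E; [apply: x2|apply: x2']; by rewrite E.
rewrite addnS -addSn; apply: IH ltjk; move: av.
have step x y : ((l * (y mod modulus) - 4 * (x mod modulus)) mod modulus
                  = (l * y - 4 * x) mod modulus)%ZZ.
  by rewrite Zminus_mod !Zmult_mod_idemp_r -Zminus_mod.
by rewrite step -GevalSS.
Qed.

(** The start 8 cannot be lowered: G_7(-3) = 2. *)
Lemma avoids_pm2_small :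
  all (fun l => avoids_pm2 l (Geval l 8 mod modulus)%ZZ
                 (Geval l 9 mod modulus)%ZZ 20000) small_Z.
Proof. by vm_compute. Qed.

Lemma Gpoly_neq_pm2 (l : int) D : `|l| <= 5 -> (8 <= D <= 20000)%N ->
  (Gpoly 5 D).[l] != 2 /\ (Gpoly 5 D).[l] != -2.
Proof.
move=> /small_ZP l5 /andP [D8 Dmax].
have /avoids_pm2P av := allP avoids_pm2_small _ l5.
have {av} [] : Geval (Z_of_int l) D <> 2%ZZ /\ Geval (Z_of_int l) D <> (-2)%ZZ.
  by rewrite -(subnKC D8); apply/av/(leq_trans _ Dmax); lia.
by rewrite -GevalE; lia.
Qed.

(** * Values of G_m at small integral 2x2 matrices *)

(* Coordinates of G_m(A) w1 in (w1, w2), when A w1 = a w1 + b w2 and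
   A w2 = c w1 + e w2. *)
Fixpoint Gspan (R : pzRingType) (a b c e : R) (m : nat) : R * R :=
  if m is m1.+1 then
    if m1 is m2.+1 then
      let: (x1, y1) := Gspan a b c e m1 in
      let: (x0, y0) := Gspan a b c e m2 in
      (a * x1 + c * y1 - 4%:R * x0, b * x1 + e * y1 - 4%:R * y0)
    else (a + 1, b)
  else (1, 0).


(** Allows the enumeration to run in [Z] and its result to be used in [int]. *)
Lemma Gspan_map (R S : pzRingType) (f : {rmorphism R -> S}) (a b c e : R) m :
  Gspan (f a) (f b) (f c) (f e) m
  = (f (Gspan a b c e m).1, f (Gspan a b c e m).2).
Proof.
elim/nat_ind2: m => [||m IH0 IH1].
- by rewrite /= rmorph1 rmorph0.
- by rewrite /= rmorphD rmorph1.
- move: IH0 IH1 => /=.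
  case: (Gspan a _ _ _ m) => [x0 y0] /= ->.
  case: (if m is _.+1 then _ else (a + 1, b)) => [x1 y1] /= ->.
  by rewrite !(rmorphB, rmorphD, rmorphM, rmorph_nat).
Qed.

(** The image of the first basis vector already suffices. Degree 2 has to be left out: a = 0, b = c
    = 2, e = -1 gives zero there. *)
Lemma Gspan_small_neq0 :
  all (fun a => all (fun b => all (fun c => all (fun e =>
    all (fun m => Gspan a b c e m != (0%ZZ, 0%ZZ)) (iota 3 5))
  small_Z) small_Z) small_Z) small_Z.
Proof. by vm_compute. Qed.

Lemma Gspan_neq0 (a b c e : int) D :
  `|a| <= 5 -> `|b| <= 5 -> `|c| <= 5 -> `|e| <= 5 -> (3 <= D <= 7)%N ->
  Gspan a b c e D != (0, 0).
Proof.
move=> /small_ZP a5 /small_ZP b5 /small_ZP c5 /small_ZP e5 D37.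
have := allP (allP (allP (allP (allP Gspan_small_neq0 _ a5) _ b5) _ c5) _ e5) D.
rewrite mem_iota => /(_ D37); apply: contra_neq => G0.
by rewrite Gspan_map G0.
Qed.

(** * Polynomials in a matrix on eigenvectors and invariant planes *)

Lemma horner_mx_eigen (R : comNzRingType) n (A : 'M[R]_n.+1) (w : 'cV_n.+1)
    (l : R) (p : {poly R}) :
  A *m w = l *: w -> horner_mx A p *m w = p.[l] *: w.
Proof.
move=> Aw; elim/poly_ind: p => [|p c IH].
  by rewrite rmorph0 mul0mx horner0 scale0r.
rewrite rmorphD rmorphM /= horner_mx_X horner_mx_C mulmxDl -mulmxA Aw.
by rewrite -scalemxAr IH mul_scalar_mx scalerA -scalerDl !hornerE mulrC.
Qed.

Lemma horner_mx_GpolySS n (A : 'M[int]_n.+1) d m :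
  horner_mx A (Gpoly d m.+2) =
  A *m horner_mx A (Gpoly d m.+1) - (d%:R - 1) *: horner_mx A (Gpoly d m).
Proof. by rewrite GpolySS rmorphB rmorphM /= horner_mx_X horner_mxZ. Qed.

Lemma horner_mx_Gspan n (A : 'M[int]_n.+1) (w1 w2 : 'cV_n.+1) a b c e m :
  A *m w1 = a *: w1 + b *: w2 -> A *m w2 = c *: w1 + e *: w2 ->
  horner_mx A (Gpoly 5 m) *m w1
  = (Gspan a b c e m).1 *: w1 + (Gspan a b c e m).2 *: w2.
Proof.
move=> Aw1 Aw2; elim/nat_ind2: m => [||m IH0 IH1].
- by rewrite /= rmorph1 mul1mx scale1r scale0r addr0.
- rewrite /= rmorphD rmorph1 /= horner_mx_X mulmxDl mul1mx Aw1 scalerDl scale1r.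
  by rewrite addrAC.
- rewrite horner_mx_GpolySS mulmxBl -mulmxA -scalemxAl IH0 IH1.
  move=> {IH0 IH1} /=.
  case: (Gspan a _ _ _ m) => [x0 y0].
  case: (if m is _.+1 then _ else (a + 1, b)) => [x1 y1] /=.
  rewrite mulmxDr -!scalemxAr Aw1 Aw2.
  by apply/matrixP => i j; rewrite !mxE; ring.
Qed.

(** Modulo 4 the recurrence at 5 reads G_{m+2} = G_{m+1}, and G_1(5) = 6. *)
Lemma Gpoly5_mod4 m : exists q : int, (Gpoly 5 m.+1).[5] = 4 * q + 2.
Proof.
elim/nat_ind2: m => [||m [q0 E0] [q1 E1]].
- by exists 1; rewrite /= !hornerE.
- by exists 6; rewrite GpolySS /= !hornerE.
- exists (5 * q1 + 2 - (4 * q0 + 2)); 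
  by rewrite GpolySS hornerD hornerN hornerZ hornerM hornerX E0 E1; ring.
Qed.

(** * Eigenvectors of a cycle matrix *)

Section CycleMatrix.

Variables (n : nat) (B : 'M[int]_n.+1) (v : {perm 'I_n.+1}).
Hypothesis n3 : (3 <= n.+1)%N.
Hypothesis vB : forall i j, B (v i) (v j) = ((j == ordS i) || (i == ordS j))%:R.

(** Indices are all naturals, read modulo the order, so that eigenvectors become periodic solutions
    of linear recurrences. *)
Definition cycle_vertex (k : nat) : 'I_n.+1 := v (inZp k).

Lemma cycle_vertexP x : exists k, x = cycle_vertex k.
Proof. by exists (v^-1%g x); rewrite /cycle_vertex valZpK permKV. Qed.

Lemma cycle_vertexD k : cycle_vertex (k + n.+1) = cycle_vertex k.
Proof. by congr (v _); apply: val_inj; rewrite /= modnDr. Qed.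

Lemma ordS_inZp k : ordS (inZp k : 'I_n.+1) = inZp k.+1.
Proof. by apply: val_inj; rewrite /= -addn1 modnDml addn1. Qed.

Lemma mul_cycle_matrix (u : 'cV[int]_n.+1) k :
  (B *m u) (cycle_vertex k.+1) 0
  = u (cycle_vertex k) 0 + u (cycle_vertex k.+2) 0.
Proof.
rewrite mxE (reindex_inj (@perm_inj _ v)) /=.
(* The two neighbours differ because the order is at least 3, so the row has two separate nonzero
   terms. *)
have neq : (inZp k : 'I_n.+1) != inZp k.+2.
  apply/eqP => /(congr1 val) /= /eqP.
  rewrite -{1}[k]addn0 -addn2 eqn_modDl mod0n modn_small //.
rewrite (bigD1 (inZp k)) //= (bigD1 (inZp k.+2)) 1?eq_sym //=.
rewrite big1 => [|j /andP [j1 j2]].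
  by rewrite !vB !ordS_inZp !eqxx orbT !mul1r addr0.
rewrite vB ordS_inZp (negPf j2) /= -ordS_inZp.
by rewrite (inj_eq (@ordS_inj _)) eq_sym (negPf j1) mul0r.
Qed.

Lemma cycle_matrix_ones : B *m const_mx 1 = 2 *: const_mx 1 :> 'cV_n.+1.
Proof.
apply/matrixP => x j; rewrite ord1.
have [k ->] := cycle_vertexP x.
(* Adding a full turn makes the index a successor, as [mul_cycle_matrix] requires. *)
rewrite -cycle_vertexD addnS.
by rewrite mul_cycle_matrix !mxE.
Qed.

Lemma cycle_matrix_sym : B^T = B.
Proof.
apply/matrixP => x y; rewrite mxE -(permKV v x) -(permKV v y) !vB.
by rewrite orbC.
Qed.

(** By symmetry of [B], computing 1^T B w in two ways gives (mu - 2) 1^T w = 0. *)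
Lemma orth_cycle_eigen (w : 'cV[int]_n.+1) (mu : int) :
  mu != 2 -> B *m w = mu *: w -> (const_mx 1 : 'M_n.+1) *m w = 0.
Proof.
move=> mu2 Bw.
have : (const_mx 1 : 'rV_n.+1) *m (B *m w) = 2 *: (const_mx 1 *m w).
  rewrite mulmxA -[X in _ *m X *m _]cycle_matrix_sym -trmx_const -trmx_mul.
  by rewrite cycle_matrix_ones linearZ /= trmx_const -scalemxAl.
rewrite Bw -scalemxAr => /eqP; rewrite -subr_eq0 -scalerBl scalemx_eq0.
rewrite subr_eq0 (negPf mu2) /= => /eqP sum0.
apply/matrixP => i j; move/matrixP: sum0 => /(_ 0 j); rewrite !mxE => {2}<-.
by apply: eq_bigr => k _; rewrite !mxE.
Qed.

Definition wave (f : nat -> int) : 'cV[int]_n.+1 := \col_x f (v^-1%g x).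

Lemma waveE f k : (forall k, f (k + n.+1)%N = f k) ->
  wave f (cycle_vertex k) 0 = f k.
Proof.
move=> per; rewrite mxE permK /= {2}(divn_eq k n.+1).
elim: (k %/ n.+1)%N => [|q IH]; first by rewrite mul0n.
by rewrite mulSn -addnA addnC per.
Qed.

Lemma cycle_wave f mu : (forall k, f (k + n.+1)%N = f k) ->
  (forall k, f k + f k.+2 = mu * f k.+1) -> B *m wave f = mu *: wave f.
Proof.
move=> per rec; apply/matrixP => x j; rewrite ord1.
have [k ->] := cycle_vertexP x.
rewrite -cycle_vertexD addnS.
by rewrite mul_cycle_matrix [RHS]mxE !waveE.
Qed.

Lemma cV_eq_cycle (u w : 'cV[int]_n.+1) :
  (forall k, u (cycle_vertex k) 0 = w (cycle_vertex k) 0) -> u = w.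
Proof.
move=> uw; apply/matrixP => x j; rewrite ord1.
by have [k ->] := cycle_vertexP x.
Qed.

Section FourDivides.

Hypothesis n4 : (4 %| n.+1)%N.

Lemma period4 (f : nat -> int) k :
  (forall k, f k.+4 = f k) -> f (k + n.+1)%N = f k.
Proof.
move=> per; case/dvdnP: n4 => q ->.
by elim: q => [|q IH]; rewrite ?mul0n ?addn0 // mulSn addnC -addnA per addnC.
Qed.

Definition alt (k : nat) : int := (-1) ^+ k.
(** The values of cos(k pi / 2) and, below, sin(k pi / 2). *)
Definition cos4 (k : nat) : int := if odd k then 0 else (-1) ^+ k./2.
Definition sin4 (k : nat) : int := if odd k then (-1) ^+ k./2 else 0.

Lemma altSS k : alt k.+2 = alt k.
Proof. by rewrite /alt !exprS !mulN1r opprK. Qed.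

Lemma cos4SS k : cos4 k.+2 = - cos4 k.
Proof. by rewrite /cos4 /= negbK exprS; case: odd; rewrite ?mulN1r ?oppr0. Qed.

Lemma sin4SS k : sin4 k.+2 = - sin4 k.
Proof. by rewrite /sin4 /= negbK exprS; case: odd; rewrite ?mulN1r ?oppr0. Qed.

Lemma alt_period k : alt (k + n.+1) = alt k.
Proof. by apply: period4 => j; rewrite !altSS. Qed.

Lemma cos4_period k : cos4 (k + n.+1) = cos4 k.
Proof. by apply: period4 => j; rewrite !cos4SS opprK. Qed.

Lemma sin4_period k : sin4 (k + n.+1) = sin4 k.
Proof. by apply: period4 => j; rewrite !sin4SS opprK. Qed.

Lemma cycle_alt : B *m wave alt = (-2) *: wave alt.
Proof.
apply: cycle_wave => [|k]; first exact: alt_period.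
by rewrite altSS /alt exprS; ring.
Qed.

Lemma cycle_cos4 : B *m wave cos4 = 0 *: wave cos4.
Proof.
apply: cycle_wave => [|k]; first exact: cos4_period.
by rewrite cos4SS; ring.
Qed.

Lemma cycle_sin4 : B *m wave sin4 = 0 *: wave sin4.
Proof.
apply: cycle_wave => [|k]; first exact: sin4_period.
by rewrite sin4SS; ring.
Qed.

(** The recurrence along the cycle has -1 as a double root, so its solutions are [alt] times affine
    sequences. *)
Lemma cycle_eigenspaceN2 (u : 'cV[int]_n.+1) :
  B *m u = (-2) *: u -> u = u (cycle_vertex 0) 0 *: wave alt.
Proof.
move=> Bu; set s := fun k => u (cycle_vertex k) 0.
have rec k : s k + s k.+2 = -2 * s k.+1.
  by rewrite /s -mul_cycle_matrix Bu mxE.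
have sE k : s k = alt k * (s 0%N - (s 1%N + s 0%N) * k%:R).
  elim/nat_ind2: k => [||k IH0 IH1].
  - by rewrite /alt; ring.
  - by rewrite /alt; ring.
  - have -> : s k.+2 = -2 * s k.+1 - s k by rewrite -rec; ring.
    by rewrite IH0 IH1 /alt !exprS -!natr1; ring.
(* An affine sequence that is periodic is constant. *)
have slope0 : s 1%N + s 0%N = 0.
  have := sE (0 + n.+1)%N.
  rewrite {1}/s cycle_vertexD -/(s 0%N) alt_period /alt expr0 mul1r add0n.
  move=> /eqP; rewrite eq_sym -subr_eq0 addrAC subrr sub0r oppr_eq0 mulf_eq0.
  by rewrite pnatr_eq0 orbF => /eqP.
apply: cV_eq_cycle => k; rewrite mxE waveE; last exact: alt_period.
by rewrite -/(s k) sE slope0 mul0r subr0 mulrC.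
Qed.

(** The recurrence s_{k+2} = - s_k is determined by two initial values. As the coordinates are
    entries of [u], they are integers and inherit its bounds. *)
Lemma cycle_kernel (u : 'cV[int]_n.+1) : B *m u = 0 *: u ->
  u = u (cycle_vertex 0) 0 *: wave cos4 + u (cycle_vertex 1) 0 *: wave sin4.
Proof.
move=> Bu; set s := fun k => u (cycle_vertex k) 0.
have rec k : s k.+2 = - s k.
  have : s k + s k.+2 = 0 by rewrite /s -mul_cycle_matrix Bu mxE mul0r.
  by move=> /eqP; rewrite addrC addr_eq0 => /eqP.
apply: cV_eq_cycle => k.
rewrite [RHS]mxE [X in _ = X + _]mxE [X in _ = _ + X]mxE.
rewrite !waveE; [|exact: sin4_period|exact: cos4_period].
rewrite -/(s k) -/(s 0%N) -/(s 1%N).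
elim/nat_ind2: k => [||k IH0 _].
- by rewrite /cos4 /sin4 /=; ring.
- by rewrite /cos4 /sin4 /=; ring.
- by rewrite rec cos4SS sin4SS IH0; ring.
Qed.

End FourDivides.

End CycleMatrix.

(** * Adjacency matrices of regular graphs *)

Section RegularGraph.

Variables (n : nat) (e : rel 'I_n.+1) (d : nat).
Hypotheses (simple_e : simple_graph e) (regular_e : regular e d).
Let A := adjacency e.

Lemma adjacency_sym : A^T = A.
Proof. by apply/matrixP => x y; rewrite !mxE; case: simple_e => ->. Qed.

Lemma adjacency_row_sum x : \sum_y A x y = d%:R.
Proof.
rewrite -(regular_e x) -sum1_card natr_sum [RHS]big_mkcond /=.
by apply: eq_bigr => y _; rewrite mxE inE; case: e.
Qed.

Lemma adjacency_ones m :
  A *m const_mx 1 = d%:R *: (const_mx 1 : 'M[int]_(n.+1, m)).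
Proof.
apply/matrixP => x j; rewrite !mxE mulr1 -(adjacency_row_sum x).
by apply: eq_bigr => y _; rewrite [const_mx _ _ _]mxE mulr1.
Qed.

(** Transposing A J = d J gives J A = d J, since both matrices are symmetric. *)
Lemma adjacency_comm_ones : comm_mx A (const_mx 1).
Proof.
rewrite /comm_mx adjacency_ones -[LHS]trmxK linearZ /= trmx_const.
by rewrite -adjacency_ones trmx_mul trmx_const adjacency_sym.
Qed.

Lemma adjacency_bound (w : 'cV[int]_n.+1) x :
  (forall y, `|w y 0| <= 1) -> `|(A *m w) x 0| <= d%:R.
Proof.
move=> w1; rewrite mxE -(adjacency_row_sum x).
apply: le_trans (ler_norm_sum _ _ _) _; apply: ler_sum => y _.
have A0 : 0 <= A x y by rewrite mxE ler0n.
by rewrite normrM (ger0_norm A0) ler_piMr.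
Qed.

End RegularGraph.

(** * The contradiction, for defect and excess together *)

Lemma cyclic_equation_false n (e : rel 'I_n.+1) (eps : int) D B :
  simple_graph e -> regular e 5 -> cycle_matrix B -> (3 <= D <= 20000)%N ->
  `|eps| = 1 ->
  horner_mx (adjacency e) (Gpoly 5 D) <> const_mx 1 + eps *: B.
Proof.
move=> simple_e regular_e [n3 [v vB]] /andP [D3 Dmax] eps1.
set A := adjacency e => GA.
have eps_pm : eps = 1 \/ eps = -1 by lia.
have n4 : (4 %| n.+1)%N.
  have := horner_mx_eigen (Gpoly 5 D) (adjacency_ones regular_e 1).
  rewrite -/A GA mulmxDl -scalemxAl (cycle_matrix_ones n3 vB).
  case: D D3 {Dmax GA} => // D _; have [q ->] := Gpoly5_mod4 D.
  move=> /matrixP /(_ 0 0); rewrite !mxE.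
  rewrite (eq_bigr (fun=> 1)) => [|k _]; last by rewrite !mxE mulr1.
  rewrite sumr_const card_ord -mulr_natr mul1r natz !mulr1.
  (* The equation is now 4 q + 2 = n.+1 + 2 eps, up to the order of terms. *)
  by case: eps_pm => ->; lia.
have commAB : comm_mx A B.
  have epsB : eps *: B = horner_mx A (Gpoly 5 D) - const_mx 1.
    by rewrite GA addrAC subrr add0r.
  (* As eps^2 = 1, [B] is eps (G_D(A) - J), and both terms commute with [A]. *)
  have -> : B = eps *: (eps *: B).
    by rewrite scalerA; case: eps_pm => ->; rewrite ?mulrNN mulr1 scale1r.
  rewrite /comm_mx -scalemxAr -scalemxAl; congr (_ *: _).
  rewrite epsB; apply: comm_mxB.
    exact/comm_mx_horner/comm_mx_refl.
  exact: adjacency_comm_ones simple_e regular_e.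
have eigenA (w : 'cV_n.+1) (mu : int) :
    B *m w = mu *: w -> B *m (A *m w) = mu *: (A *m w).
  by move=> Bw; rewrite mulmxA -commAB -mulmxA Bw -scalemxAr.
have GAw (w : 'cV_n.+1) (mu : int) : mu != 2 -> B *m w = mu *: w ->
    horner_mx A (Gpoly 5 D) *m w = (eps * mu) *: w.
  move=> mu2 Bw; rewrite GA mulmxDl (orth_cycle_eigen n3 vB mu2 Bw) add0r.
  by rewrite -scalemxAl Bw scalerA.
have bound f k : (forall k, `|f k| <= 1) ->
    `|(A *m wave v f) (cycle_vertex v k) 0| <= 5.
  by move=> f1; apply: adjacency_bound => // y; rewrite mxE.
have cos4_le1 k : `|cos4 k| <= 1.
  by rewrite /cos4; case: odd; rewrite ?normr0 // normrX normrN1 expr1n.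
have sin4_le1 k : `|sin4 k| <= 1.
  by rewrite /sin4; case: odd; rewrite ?normr0 // normrX normrN1 expr1n.
have alt_le1 k : `|alt k| <= 1 by rewrite /alt normrX normrN1 expr1n.
have [D7|D8] := leqP D 7.
  have Bcos := cycle_cos4 n3 vB n4; have Bsin := cycle_sin4 n3 vB n4.
  have Acos := cycle_kernel n3 vB n4 (eigenA _ _ Bcos).
  have Asin := cycle_kernel n3 vB n4 (eigenA _ _ Bsin).
  have := GAw _ 0 isT Bcos.
  rewrite (horner_mx_Gspan D Acos Asin) mulr0 scale0r.
  have /negP := Gspan_neq0 (bound _ 0 cos4_le1) (bound _ 1 cos4_le1)
    (bound _ 0 sin4_le1) (bound _ 1 sin4_le1) (introT andP (conj D3 D7)).
  case: Gspan => x y /= xy0 span0; apply: xy0.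
  (* The two waves are independent: vertices 0 and 1 isolate [x] and [y]. *)
  have at_vertex k : x * cos4 k + y * sin4 k = 0.
    move/matrixP: span0 => /(_ (cycle_vertex v k) 0).
    rewrite [LHS]mxE [X in X + _]mxE [X in _ + X]mxE [RHS]mxE.
    by rewrite !waveE // => ?; rewrite (cos4_period, sin4_period).
  have := at_vertex 0%N; rewrite mulr1 mulr0 addr0 => ->.
  by have := at_vertex 1%N; rewrite mulr1 mulr0 add0r => ->.
have Balt := cycle_alt n3 vB n4.
have Aalt := cycle_eigenspaceN2 n3 vB n4 (eigenA _ _ Balt).
have := GAw _ (-2) isT Balt; rewrite (horner_mx_eigen _ Aalt).
set l := (A *m _) _ _.
have [G2 GN2] := Gpoly_neq_pm2 (bound alt 0%N alt_le1 : `|l| <= 5)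
  (introT andP (conj D8 Dmax)).
(* At vertex 0 the alternating wave is 1, which leaves G_D(l) = -2 eps. *)
move=> /matrixP /(_ (cycle_vertex v 0) 0).
rewrite [LHS]mxE [RHS]mxE waveE; last exact: alt_period.
rewrite /alt expr0 !mulr1 => El.
by case: eps_pm El G2 GN2 => -> ->.
Qed.

Local Close Scope ring_scope.

Theorem theorem6 :
  (forall D : nat, 3 <= D <= 20000 ->
    forall (n : nat) (e : rel 'I_n.+1), ~ cyclic_defect e 5 D) /\
  (forall g : nat, odd g -> 7 <= g <= 40001 ->
    forall (n : nat) (e : rel 'I_n.+1), ~ cyclic_excess e 5 g).
Proof.
split=> [D D_range n e [simple_e [regular_e _] _ [B cycB eqB]] |
         g odd_g g_range n e [simple_e [regular_e _] _ [B cycB eqB]]].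
  apply: (cyclic_equation_false simple_e regular_e cycB D_range (normr1 _)).
  by rewrite scale1r.
have half_range : 3 <= g./2 <= 20000.
  by case/andP: g_range => g7 g_max; rewrite (half_leq g7) (half_leq g_max).
apply: (cyclic_equation_false simple_e regular_e cycB half_range (normrN1 _)).
by rewrite scaleN1r.
Qed.
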